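(* Let $n$ be a positive integer, let $S$ be a bipotent semiring, let $X \subseteq UT_n(S)$ be a finite set, and let $T = \langle X \rangle$ be the subsemigroup of $UT_n(S)$ generated by $X$. If the growth function of the subsemigroup of $(S,\cdot)$ generated by the entries of the matrices in $X$ is bounded above by a polynomial of degree $t \in \mathbb{N}_0$, then the growth function of $T$ is bounded above by a polynomial of degree $\frac{tn(n+1)}{2}$.
   Context: $\mathbb{N}$ is the set of positive integers and $\mathbb{N}_0$ the set of non-negative integers. A semiring $S$ is a set with two operations $+,\cdot$ such that $(S,+)$ is a commutative monoid with identity $0_S$, $(S,\cdot)$ is a monoid with identity $1_S$, multiplication distributes over addition on both sides, and $x0_S = 0_Sx = 0_S$ for all $x$. $S$ is bipotent if $x+y\in\{x,y\}$ for all $x,y\in S$. $UT_n(S)$ is the monoid, under matrix multiplication, of all $n\times n$ matrices over $S$ with all entries below the diagonal equal to $0_S$. For a semigroup generated by a finite set $X$, its growth function with respect to $X$ is $f_X(k) = |\bigcup_{i=1}^k X^i|$ for $k\in\mathbb{N}$, where $X^i$ is the set of products of $i$ elements of $X$. It is bounded above by a polynomial of degree $m$ if there is $c_X>0$ such that $f_X(k)\le c_Xk^m$ for all $k\in\mathbb{N}$. This property does not depend on the choice of finite generating set, so one says that the growth function of the semigroup is bounded above by a polynomial of degree $m$ without reference to a generating set. *)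

(* Defs.v *)
From HB Require Import structures.
From mathcomp Require Import all_boot all_order all_algebra.
From mathcomp Require Import finmap boolp classical_sets.

Set Implicit Arguments.
Unset Strict Implicit.
Unset Printing Implicit Defensive.

Import GRing.Theory.

Local Open Scope classical_set_scope.

Section SemigroupGrowth.

(* A semigroup is given by its carrier and its (associative) law. *)
Variables (T : choiceType) (mul : SemiGroup.law T).
Implicit Types (X Y : {fset T}) (G : set T).

Definition subsemigroup G : Prop :=
  forall x y : T, G x -> G y -> G (mul x y).

Definition generated X : set T := smallest subsemigroup [set` X].

Definition set_mul X Y : {fset T} := [fset mul x y | x in X, y in Y]%fset.

(* X^i for i >= 1; the value at i = 0 is junk and is never used. *)
Definition set_pow X i : {fset T} := iter i.-1 (set_mul X) X.

Definition growth X k : nat :=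
  #|` (\bigcup_(i <- iota 1 k) set_pow X i)%fset |%fset.

(* As f takes its values in nat, it is no restriction to take the positive
   constant c in nat. *)
Definition poly_bounded (f : nat -> nat) (m : nat) : Prop :=
  exists2 c : nat, 0 < c & forall k, 0 < k -> f k <= c * k ^ m.

(* "The growth function of the semigroup G is bounded above by a polynomial of
   degree m"; by growth_boundedP below, any finite generating set may be used
   to test this. *)
Definition growth_bounded G (m : nat) : Prop :=
  exists2 X, generated X = G & poly_bounded (growth X) m.

Lemma set_powS X i : 0 < i -> set_pow X i.+1 = set_mul X (set_pow X i).
Proof. by case: i. Qed.

Lemma set_mulP X Y z :
  reflect (exists2 x, x \in X & exists2 y, y \in Y & z = mul x y)
          (z \in set_mul X Y).
Proof. exact: imfset2P. Qed.

Lemma set_powD X i j x y : 0 < i -> 0 < j ->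
  x \in set_pow X i -> y \in set_pow X j -> mul x y \in set_pow X (i + j).
Proof.
move=> + j0; elim: i x => // -[|i] IH x _ xX yX.
  by rewrite set_powS//; apply/set_mulP; exists x => //; exists y.
move: xX; rewrite set_powS// => /set_mulP[a aX [b bX ->]].
rewrite addSn set_powS ?addSn//; apply/set_mulP; exists a => //.
by exists (mul b y); [exact: IH | rewrite SemiGroup.opA].
Qed.

Lemma generatedP X x :
  generated X x <-> exists2 i, 0 < i & x \in set_pow X i.
Proof.
split=> [|[i]].
  move=> /(_ [set y | exists2 i, 0 < i & y \in set_pow X i]); apply; split.
    move=> a b [i i0 ai] [j j0 bj].
    by exists (i + j); [rewrite addn_gt0 i0 | exact: set_powD].
  by move=> a aX; exists 1.
elim: i x => // -[|i] IH x _; first by move=> xX; apply: sub_gen_smallest.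
rewrite set_powS// => /set_mulP[a aX [b bX ->]] A [sA XA].
by apply: (sA); [exact: XA | exact: (IH _ _ bX) _ (conj sA XA)].
Qed.

Lemma ballP X k x :
  reflect (exists2 i, 0 < i <= k & x \in set_pow X i)
          (x \in (\bigcup_(i <- iota 1 k) set_pow X i)%fset).
Proof.
apply: (iffP (bigfcupP _ _ _ _)) => -[i].
  by rewrite andbT mem_iota add1n ltnS => ik xi; exists i.
by move=> ik xi; exists i => //; rewrite andbT mem_iota add1n ltnS.
Qed.

Lemma poly_bounded_generated X Y m : generated X = generated Y ->
  poly_bounded (growth X) m -> poly_bounded (growth Y) m.
Proof.
move=> XY [c c0 fX].
have [M M0 YM] : exists2 M, 0 < M &
    forall y, y \in Y -> exists2 i, 0 < i <= M & y \in set_pow X i.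
  have : forall y, exists i, y \in Y -> 0 < i /\ y \in set_pow X i.
    move=> y; have [yY|] := boolP (y \in Y); last by exists 0.
    have : generated Y y by apply: sub_gen_smallest.
    by rewrite -XY => /generatedP[i i0 yi]; exists i.
  move=> /choice[g gP]; exists (\sum_(y <- enum_fset Y) g y).+1 => // y yY.
  have [g0 yg] := gP y yY; exists (g y) => //; rewrite g0 /=.
  by rewrite (big_rem y)//= leqW// leq_addr.
have YX k y : 0 < k -> y \in set_pow Y k ->
    exists2 i, 0 < i <= M * k & y \in set_pow X i.
  elim: k y => // -[|k] IH y _; first by rewrite muln1; exact: YM.
  rewrite set_powS// => /set_mulP[a /YM[i /andP[i0 iM] ai] [b bY ->]].
  have [j /andP[j0 jM] bj] := IH b isT bY.
  by exists (i + j); [rewrite addn_gt0 i0 mulnS leq_add | exact: set_powD].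
exists (c * M ^ m); first by rewrite muln_gt0 c0 expn_gt0 M0.
move=> k k0; rewrite -mulnA -expnMn.
apply: leq_trans (fX (M * k) _); last by rewrite muln_gt0 M0.
apply: fsubset_leq_card; apply/fsubsetP => y /ballP[i /andP[i0 ik] yi].
have [j /andP[j0 jM] yj] := YX i y i0 yi.
by apply/ballP; exists j; rewrite // j0 (leq_trans jM)// leq_mul2l ik orbT.
Qed.

Lemma growth_boundedP X m :
  growth_bounded (generated X) m <-> poly_bounded (growth X) m.
Proof.
by split=> [[Y YX]|bX]; [exact: poly_bounded_generated | exists X].
Qed.

End SemigroupGrowth.

Definition bipotent (S : pzSemiRingType) : Prop :=
  forall x y : S, (x + y)%R = x \/ (x + y)%R = y.

(* MathComp's is_trig_mx means *lower* triangular, hence this definition. *)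
Definition UT (n : nat) (S : pzSemiRingType) : set 'M[S]_n :=
  [set A | forall i j : 'I_n, j < i -> A i j = 0%R].
Arguments UT : clear implicits.

Definition entries (n : nat) (S : pzSemiRingType) (X : {fset 'M[S]_n}) :
    {fset S} :=
  (\bigcup_(A <- X) [fset A i j | i in 'I_n, j in 'I_n])%fset.

(* Main.v *)
Require Import Defs.
From mathcomp Require Import all_boot all_order all_algebra.
From mathcomp Require Import finmap boolp classical_sets.

(** Write E for the set of entries of the matrices in X.  An entry of a product
    of i matrices from X is a sum, over walks of length i, of products of i
    elements of E.  In a bipotent semiring a nonempty sum is equal to one of its
    terms, so the addition disappears: every entry of the product lies in E^i
    ([set_pow_entry]).  Hence the entries of all matrices in the ball of radius
    k of T lie in the ball of radius k of the multiplicative semigroup generated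
    by E, which has at most c k^t elements.  An upper triangular matrix is
    determined by its n(n+1)/2 entries on and above the diagonal, so the ball of
    T has at most (c k^t)^(n(n+1)/2) elements ([card_UT_le]). *)

Set Implicit Arguments.
Unset Strict Implicit.
Unset Printing Implicit Defensive.

Import GRing.Theory.

Local Open Scope classical_set_scope.

Lemma entriesP (n : nat) (S : pzSemiRingType) (X : {fset 'M[S]_n}) (x : S) :
  reflect (exists2 A, A \in X & exists i j, x = A i j) (x \in entries X).
Proof.
apply: (iffP (bigfcupP _ _ _ _)) => [[A]|[A AX [i [j ->]]]].
  rewrite andbT => AX /imfset2P[i _ [j _ ->]].
  by exists A => //; exists i, j.
by exists A; rewrite ?AX//; apply/imfset2P; exists i => //; exists j.
Qed.

(** By induction on the number of terms, since each addition returns one of its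
    arguments.  The index type is nonempty because an empty sum has no term to be
    equal to. *)
Lemma bipotent_sum (S : pzSemiRingType) (m : nat) (F : 'I_m.+1 -> S) :
  bipotent S -> exists i, (\sum_(j < m.+1) F j)%R = F i.
Proof.
move=> S_bipotent; elim: m F => [|m IH] F.
  by exists ord0; rewrite big_ord1.
rewrite big_ord_recl.
have [i ->] := IH (fun j => F (lift ord0 j)).
by have [->|->] := S_bipotent (F ord0) (F (lift ord0 i)); eexists.
Qed.

(** Bipotence selects one walk from p to q among those whose weights add up to
    A p q, and the weight of a walk is a product of exactly i entries.  Walks
    through a zero entry are no exception: that zero is itself an entry, so the
    sum can run over all walks whatever the shape of the matrices. *)
Lemma set_pow_entry (n : nat) (S : pzSemiRingType) (X : {fset 'M[S]_n}) i A p q :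
  bipotent S -> 0 < i -> A \in set_pow *%R X i ->
  A p q \in set_pow *%R (entries X) i.
Proof.
move=> S_bipotent; elim: i A p q => // -[|i] IH A p q _.
  by move=> AX; apply/entriesP; exists A => //; exists p, q.
rewrite set_powS// => /set_mulP[B BX [C CX ->]]; rewrite set_powS//.
case: n X p q IH A B BX C CX => [|n] X p q IH _ B BX C CX; first by case: p.
rewrite mxE; have [r ->] := bipotent_sum (fun r => (B p r * C r q)%R) S_bipotent.
apply/set_mulP; exists (B p r); first by apply/entriesP; exists B => //; exists p, r.
by exists (C r q) => //; exact: IH.
Qed.

Lemma UT_subsemigroup (n : nat) (S : pzSemiRingType) :
  subsemigroup *%R (UT n S).
Proof.
move=> A B UA UB i j lt_ji; rewrite mxE big1// => k _.
have [lt_ki|le_ik] := ltnP k i; first by rewrite UA// mul0r.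
by rewrite UB ?mulr0// (leq_trans lt_ji).
Qed.

Lemma card_upper_triangle (n : nat) :
  #|{: {p : 'I_n * 'I_n | p.1 <= p.2}}| = 'C(n.+1, 2).
Proof.
rewrite card_sig -sum1_card.
rewrite (eq_bigl (fun p : 'I_n * 'I_n => true && (p.1 <= p.2)))//.
(* Column j has j + 1 positions on and above the diagonal. *)
rewrite -(pair_big_dep xpredT (fun i j : 'I_n => i <= j) (fun _ _ => 1))/=.
rewrite (exchange_big_dep xpredT)//=.
rewrite -bin2_sum big_nat_recl// add0n big_mkord; apply: eq_bigr => j _.
rewrite -(big_ord_widen_leq _ xpredT (fun=> 1) (ltn_ord j)).
by rewrite sum1_card card_ord.
Qed.

(** Restriction to the positions on and above the diagonal is injective on UT n S,
    and it takes its values among the functions from these positions to the set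
    of entries. *)
Lemma card_UT_le (n : nat) (S : pzSemiRingType) (Z : {fset 'M[S]_n}) :
  [set` Z] `<=` UT n S -> #|` Z| <= #|` entries Z| ^ 'C(n.+1, 2).
Proof.
move=> Z_UT; pose P : finType := {p : 'I_n * 'I_n | p.1 <= p.2}.
have entryZ (A : Z) (p : P) : val A (val p).1 (val p).2 \in entries Z.
  by apply/entriesP; exists (val A); [exact: valP | eexists; eexists].
pose upper (A : Z) : {ffun P -> entries Z} := [ffun p => FSetSub (entryZ A p)].
have upper_inj : injective upper.
  move=> A B /ffunP eqAB; apply/val_inj/matrixP => i j.
  have [lt_ji|le_ij] := ltnP j i; first by rewrite !Z_UT//; exact: valP.
  pose p : P := exist _ (i, j) le_ij.
  by have /(congr1 val) := eqAB p; rewrite !ffunE.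
by have := leq_card upper upper_inj; rewrite card_ffun card_upper_triangle -!cardfE.
Qed.

(* In the conclusion *%R is the product of the semiring 'M[S]_n, i.e. mulmx;
   t * n * n.+1 is even, so %/ is exact here. *)
Theorem proposition6p5 (n : nat) (n_gt0 : 0 < n) (S : pzSemiRingType)
    (S_bipotent : bipotent S) (X : {fset 'M[S]_n}) (X_UT : [set` X] `<=` UT n S)
    (t : nat) :
  growth_bounded *%R (generated *%R (entries X)) t ->
  growth_bounded *%R (generated *%R X) ((t * n * n.+1) %/ 2).
Proof.
(* Growth may be tested on any generating set, so the hypothesis can be read on
   the entries of X themselves, as the inclusion of balls requires. *)
move=> /growth_boundedP[c c_gt0 growthE]; apply/growth_boundedP.
have -> : (t * n * n.+1) %/ 2 = t * 'C(n.+1, 2).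
  by rewrite bin2 /= -divn2 muln_divA ?dvdn2 ?oddM ?oddS ?andNb// mulnA mulnAC.
exists (c ^ 'C(n.+1, 2)) => [|k k_gt0]; first by rewrite expn_gt0 c_gt0.
rewrite expnM -expnMn.
apply: leq_trans (card_UT_le _) _ => [A /ballP[i /andP[i_gt0 _] Ai]|].
  have : generated *%R X A by apply/generatedP; exists i.
  by apply; split=> //; exact: UT_subsemigroup.
rewrite leq_exp2r ?bin_gt0//; apply: leq_trans (growthE k k_gt0).
apply/fsubset_leq_card/fsubsetP => x /entriesP[A /ballP[i ik Ai] [p [q ->]]].
apply/ballP; exists i => //; apply: set_pow_entry => //.
by case/andP: ik.
Qed.
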